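(* Let $\mathfrak m$ be an uncountable cardinal with $\sup\{\mathfrak m^{\mathfrak n}:\mathfrak n<\mathfrak m\}=\mathfrak m$. Every metrizable SIN topological group of weight $\le\mathfrak m$ is isomorphic to a topological subgroup of $\mathrm{Iso}(\mathbb U_{\mathfrak m})$.
   Context: $\mathbb U_{\mathfrak m}$ is the Urysohn–Katětov space of weight $\mathfrak m$: the complete metric space of density $\mathfrak m$ containing an isometric copy of every metric space of weight $\le\mathfrak m$ and $\mathfrak m$-homogeneous (every isometry between subsets of cardinality $<\mathfrak m$ extends to an isometry of the whole space); $\mathrm{Iso}(\mathbb U_{\mathfrak m})$ carries the topology of pointwise convergence. A topological group is SIN if its left and right uniform structures coincide, equivalently if it has a neighbourhood base at the identity of conjugation-invariant sets. *)

(* Defs.v *)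
From Stdlib Require Import Reals List Classical.
Open Scope R_scope.

(** * Cardinal comparisons, with cardinals represented by types *)
Definition injective {A B : Type} (f : A -> B) : Prop :=
  forall x y, f x = f y -> x = y.
Definition surjective {A B : Type} (f : A -> B) : Prop :=
  forall y, exists x, f x = y.

Definition card_le (A B : Type) : Prop := exists f : A -> B, injective f.
Definition card_lt (A B : Type) : Prop := card_le A B /\ ~ card_le B A.
Definition card_eq (A B : Type) : Prop :=
  exists f : A -> B, injective f /\ surjective f.

Definition uncountable (M : Type) : Prop := ~ card_le M nat.

(** sup { |M|^|N| : |N| < |M| } = |M|, literally: |M| is an upper bound of
    the family, and it is below every upper bound. *)
Definition sup_pow_below_eq (M : Type) : Prop :=
  (forall N : Type, card_lt N M -> card_le (N -> M) M) /\
  (forall K : Type,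
     (forall N : Type, card_lt N M -> card_le (N -> M) K) -> card_le M K).

Definition is_topology {T : Type} (opn : (T -> Prop) -> Prop) : Prop :=
  opn (fun _ => True) /\
  (forall S1 S2, opn S1 -> opn S2 -> opn (fun x => S1 x /\ S2 x)) /\
  (forall F : (T -> Prop) -> Prop, (forall S, F S -> opn S) ->
     opn (fun x => exists S, F S /\ S x)).

Definition weight_le {T : Type} (opn : (T -> Prop) -> Prop) (M : Type) : Prop :=
  exists (I : Type) (B : I -> T -> Prop),
    card_le I M /\ (forall i, opn (B i)) /\
    (forall S x, opn S -> S x -> exists i, B i x /\ forall y, B i y -> S y).

Definition nbhd {T : Type} (opn : (T -> Prop) -> Prop) (p : T) (S : T -> Prop) :=
  exists O, opn O /\ O p /\ forall x, O x -> S x.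

Definition is_metric {T : Type} (d : T -> T -> R) : Prop :=
  (forall x y, 0 <= d x y) /\
  (forall x y, d x y = 0 <-> x = y) /\
  (forall x y, d x y = d y x) /\
  (forall x y z, d x z <= d x y + d y z).

Record MetricSpace := {
  ms_car :> Type;
  ms_d : ms_car -> ms_car -> R;
  ms_metric : is_metric ms_d }.

Arguments ms_d {m} _ _.

Definition mopen {T : Type} (d : T -> T -> R) (S : T -> Prop) : Prop :=
  forall x, S x -> exists eps, 0 < eps /\ forall y, d x y < eps -> S y.

Definition complete (X : MetricSpace) : Prop :=
  forall u : nat -> X,
    (forall eps, 0 < eps -> exists N, forall n m, (N <= n)%nat -> (N <= m)%nat ->
        ms_d (u n) (u m) < eps) ->
    exists l : X, forall eps, 0 < eps -> exists N, forall n, (N <= n)%nat ->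
        ms_d (u n) l < eps.

Definition dense (X : MetricSpace) (D : X -> Prop) : Prop :=
  forall x eps, 0 < eps -> exists y, D y /\ ms_d x y < eps.

Definition density_eq (X : MetricSpace) (M : Type) : Prop :=
  (exists D : X -> Prop, dense X D /\ card_eq {x | D x} M) /\
  (forall D : X -> Prop, dense X D -> card_le M {x | D x}).

Definition isometric_embedding {X Y : MetricSpace} (f : X -> Y) : Prop :=
  forall x y, ms_d (f x) (f y) = ms_d x y.

Definition is_isometry {X : MetricSpace} (f : X -> X) : Prop :=
  isometric_embedding f /\ surjective f.

Definition urysohn_katetov (M : Type) (U : MetricSpace) : Prop :=
  complete U /\
  density_eq U M /\
  (forall X : MetricSpace, weight_le (mopen (@ms_d X)) M ->
     exists f : X -> U, isometric_embedding f) /\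
  (forall (A B : U -> Prop) (g : {x | A x} -> {x | B x}),
     card_lt {x | A x} M ->
     (forall a b, ms_d (proj1_sig (g a)) (proj1_sig (g b)) =
                  ms_d (proj1_sig a) (proj1_sig b)) ->
     surjective g ->
     exists h : U -> U, is_isometry h /\ forall a, h (proj1_sig a) = proj1_sig (g a)).

Definition popen (U : MetricSpace) (O : (U -> U) -> Prop) : Prop :=
  forall f, O f -> exists (xs : list U) (eps : R), 0 < eps /\
    forall h, (forall x, In x xs -> ms_d (h x) (f x) < eps) -> O h.

Record TopGroup := {
  tg_car :> Type;
  tg_mul : tg_car -> tg_car -> tg_car;
  tg_inv : tg_car -> tg_car;
  tg_one : tg_car;
  tg_open : (tg_car -> Prop) -> Prop;
  tg_assoc : forall x y z, tg_mul x (tg_mul y z) = tg_mul (tg_mul x y) z;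
  tg_mul1g : forall x, tg_mul tg_one x = x;
  tg_mulVg : forall x, tg_mul (tg_inv x) x = tg_one;
  tg_topology : is_topology tg_open;
  tg_mul_cont : forall x y W, tg_open W -> W (tg_mul x y) ->
     exists U V, tg_open U /\ tg_open V /\ U x /\ V y /\
       forall a b, U a -> V b -> W (tg_mul a b);
  tg_inv_cont : forall W, tg_open W -> tg_open (fun a => W (tg_inv a)) }.

Definition metrizable (G : TopGroup) : Prop :=
  exists d : G -> G -> R, is_metric d /\ forall S, tg_open G S <-> mopen d S.

Definition SIN_group (G : TopGroup) : Prop :=
  forall W, nbhd (tg_open G) (tg_one G) W ->
    exists V, nbhd (tg_open G) (tg_one G) V /\ (forall x, V x -> W x) /\
      forall g x, V x -> V (tg_mul G (tg_mul G g x) (tg_inv G g)).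

(** G is isomorphic (as a topological group) to a topological subgroup of
    Iso(U) with the topology of pointwise convergence: an injective group
    homomorphism into Iso(U) which is a homeomorphism onto its image. *)
Definition embeds_in_Iso (G : TopGroup) (U : MetricSpace) : Prop :=
  exists phi : G -> (U -> U),
    (forall g, is_isometry (phi g)) /\
    (forall g h, phi (tg_mul G g h) = (fun x => phi g (phi h x))) /\
    injective phi /\
    (forall O, popen U O -> tg_open G (fun g => O (phi g))) /\
    (forall W, tg_open G W -> exists O, popen U O /\ forall g, W g <-> O (phi g)).

(* Main.v *)
(** A metrizable SIN group has a conjugation-invariant length [N] inducing its
    topology (Birkhoff-Kakutani with invariant neighbourhoods).  Call a
    pseudometric space with an isometric action of [G] good if every [g] moves
    every point by at most [N g].  This bound passes to Katetov functions, since
    they are 1-Lipschitz, so that one may adjoin to a good space the whole orbit of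
    a Katetov function and stay good.  Since [m^n <= m] for [n < m], [m] is
    regular and, starting from [G] itself, [m] such steps produce a good space of
    cardinality [m] in which every Katetov function on fewer than [m] points is
    realised.  [U] has the same extension property and cardinality [m], so a back
    and forth of length [m] identifies the two, and the action is transported to
    [U]; the uniform displacement bound makes it continuous, and the orbit of
    [1] in [G] makes it a homeomorphism onto its image. *)

Require Import Defs.
From Stdlib Require Import Reals List Classical.
From Stdlib Require Import Arith ZArith ClassicalEpsilon FunctionalExtensionality
  PropExtensionality Wellfounded Lra Lia.
From mathcomp Require ssrbool eqtype boolp wochoice.
Import ListNotations.
Open Scope R_scope.
Set Bullet Behavior "Strict Subproofs".

(** * Well-orders *)

Definition strict_well_order {M : Type} (lt : M -> M -> Prop) : Prop :=
  well_founded lt /\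
  (forall x y z, lt x y -> lt y z -> lt x z) /\
  (forall x y, lt x y \/ x = y \/ lt y x).

(** The well-ordering principle gives every nonempty subset a unique least element. Uniqueness on
    two-element sets yields antisymmetry, least elements of three-element sets yield transitivity,
    and the strict part is the order sought. *)
Lemma strict_well_order_exists (M : Type) :
  exists lt : M -> M -> Prop, strict_well_order lt.
Proof.
  destruct (wochoice.well_ordering_principle
    (boolp.boolp_classicType__canonical__eqtype_Equality M)) as [le Hle].
  set (leP := fun x y : M => le x y = true).
  assert (Hmin : forall P : M -> Prop, (exists x, P x) ->
    exists z, P z /\ (forall x, P x -> leP z x) /\
      forall z', P z' -> (forall x, P x -> leP z' x) -> z = z').
  { intros P [x0 Hx0].
    destruct (Hle (fun x => boolp.asbool (P x))) as [z [[Hz1 Hz2] Huniq]].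
    - exists x0. exact (ssrbool.introT (boolp.asboolP (P x0)) Hx0).
    - exists z. split; [|split].
      + exact (ssrbool.elimT (boolp.asboolP (P z)) Hz1).
      + intros x Hx. exact (Hz2 x (ssrbool.introT (boolp.asboolP (P x)) Hx)).
      + intros z' Hz' H. apply Huniq. split.
        * exact (ssrbool.introT (boolp.asboolP (P z')) Hz').
        * intros x Hx. exact (H x (ssrbool.elimT (boolp.asboolP (P x)) Hx)). }
  assert (Hanti : forall x y, leP x y -> leP y x -> x = y).
  { intros x y Hxy Hyx.
    destruct (Hmin (fun z => z = x \/ z = y)) as [z [Hz [Hl Hu]]]; [eauto|].
    assert (Hx := Hl x (or_introl eq_refl)). assert (Hy := Hl y (or_intror eq_refl)).
    assert (Hr : forall w, leP w w).
    { intros w. destruct (Hmin (fun z => z = w)) as [v [-> [Hv _]]]; eauto. }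
    transitivity z; [symmetry|]; apply Hu; auto; intros ? [-> | ->]; auto. }
  exists (fun x y => leP x y /\ x <> y). split; [|split].
  - intros a. apply NNPP. intros Ha.
    destruct (Hmin (fun x => ~ Acc (fun x y => leP x y /\ x <> y) x)) as [z [Hz [Hl _]]];
      [eauto|].
    apply Hz. constructor. intros y [Hy1 Hy2]. apply NNPP. intros Hy.
    apply Hy2, Hanti; auto.
  - intros x y z [Hxy Nxy] [Hyz Nyz].
    destruct (Hmin (fun w => w = x \/ w = y \/ w = z)) as [w [Hw [Hl _]]]; [eauto|].
    destruct Hw as [-> | [-> | ->]].
    + split; [apply Hl; auto|]. intros ->. apply Nxy, Hanti; auto.
    + exfalso. apply Nxy, Hanti; auto.
    + exfalso. apply Nyz, Hanti; auto.
  - intros x y. destruct (classic (x = y)) as [-> | N]; [auto|].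
    destruct (Hmin (fun w => w = x \/ w = y)) as [w [[-> | ->] [Hl _]]]; [eauto|left|right;right];
      split; auto.
Qed.

(** * Invariant lengths on SIN groups *)

Lemma glb_exists (E : R -> Prop) (b : R) :
  (exists x, E x) -> (forall x, E x -> b <= x) ->
  exists m, (forall x, E x -> m <= x) /\ (forall c, (forall x, E x -> c <= x) -> c <= m).
Proof.
  intros [x0 Hx0] Hb.
  destruct (completeness (fun y => E (- y))) as [m [Hm1 Hm2]].
  - exists (- b). intros y Hy. specialize (Hb _ Hy). lra.
  - exists (- x0). now rewrite Ropp_involutive.
  - exists (- m). split.
    + intros x Hx. enough (- x <= m) by lra. apply Hm1. now rewrite Ropp_involutive.
    + intros c Hc. enough (m <= - c) by lra. apply Hm2. intros y Hy.
      specialize (Hc _ Hy). lra.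
Qed.

Section Group.
Variable G : TopGroup.
Local Notation "x * y" := (tg_mul G x y).
Local Notation "1" := (tg_one G).
Local Notation inv := (tg_inv G).

Lemma tg_mulKg (x y : G) : inv x * (x * y) = y.
Proof. now rewrite tg_assoc, tg_mulVg, tg_mul1g. Qed.

Lemma tg_mulgV (x : G) : x * inv x = 1.
Proof.
  rewrite <- (tg_mul1g G (x * inv x)), <- (tg_mulVg G (inv x)) at 1.
  now rewrite <- tg_assoc, (tg_assoc G (inv x) x), tg_mulVg, tg_mul1g, tg_mulVg.
Qed.

Lemma tg_mulg1 (x : G) : x * 1 = x.
Proof. now rewrite <- (tg_mulVg G x), tg_assoc, tg_mulgV, tg_mul1g. Qed.

Lemma tg_mulVKg (x y : G) : x * (inv x * y) = y.
Proof. now rewrite tg_assoc, tg_mulgV, tg_mul1g. Qed.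

Lemma tg_inv_unique (x y : G) : x * y = 1 -> inv x = y.
Proof. intros H. now rewrite <- (tg_mulKg x y), H, tg_mulg1. Qed.

Lemma tg_invK (x : G) : inv (inv x) = x.
Proof. apply tg_inv_unique, tg_mulVg. Qed.

Lemma tg_invM (x y : G) : inv (x * y) = inv y * inv x.
Proof. apply tg_inv_unique. now rewrite <- tg_assoc, tg_mulVKg, tg_mulgV. Qed.

Lemma tg_inv1 : inv 1 = 1.
Proof. apply tg_inv_unique, tg_mul1g. Qed.

Lemma tg_conjM (g x y : G) : g * (x * y) * inv g = (g * x * inv g) * (g * y * inv g).
Proof. now rewrite <- !tg_assoc, tg_mulKg. Qed.

(** These clauses make [N (inv g * h)] a bi-invariant pseudometric that induces the topology. *)
Definition compatible_length (N : G -> R) : Prop :=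
  N 1 = 0 /\ (forall g, 0 <= N g) /\
  (forall g, N (inv g) = N g) /\
  (forall g h, N (g * h) <= N g + N h) /\
  (forall g h, N (g * h * inv g) = N h) /\
  (forall W, tg_open G W <->
     forall g, W g -> exists eps, 0 < eps /\ forall h, N (inv g * h) < eps -> W h).

(** * Chains of group elements and the length that they define *)

Fixpoint chain_cost (l : list (nat * G)) : R :=
  match l with [] => 0 | p :: l => (/ 2) ^ fst p + chain_cost l end.

Fixpoint chain_prod (l : list (nat * G)) : G :=
  match l with [] => 1 | p :: l => snd p * chain_prod l end.

Lemma chain_cost_app l1 l2 : chain_cost (l1 ++ l2) = chain_cost l1 + chain_cost l2.
Proof. induction l1; simpl; lra. Qed.

Lemma chain_prod_app l1 l2 : chain_prod (l1 ++ l2) = chain_prod l1 * chain_prod l2.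
Proof. induction l1; simpl; [now rewrite tg_mul1g|]. now rewrite IHl1, tg_assoc. Qed.

Lemma half_pow_pos n : 0 < (/ 2) ^ n.
Proof. apply pow_lt; lra. Qed.

Lemma chain_cost_ge0 l : 0 <= chain_cost l.
Proof. induction l as [|p l IH]; simpl; [lra|]. pose proof (half_pow_pos (fst p)); lra. Qed.

Lemma half_pow_lt m n : (/ 2) ^ m < (/ 2) ^ n -> (n < m)%nat.
Proof.
  intros H. apply Nat.nle_gt. intros Hle. apply (Rlt_not_le _ _ H).
  replace n with (m + (n - m))%nat by lia. rewrite pow_add.
  assert ((/ 2) ^ (n - m) <= 1).
  { rewrite <- (pow1 (n - m)). apply pow_incr. lra. }
  pose proof (half_pow_pos m). nra.
Qed.

(** The link [x] is the first whose inclusion takes the running cost beyond [c], or the last link if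
    the total is exactly [c]. *)
Lemma chain_split l c :
  0 <= c -> l <> [] -> c <= chain_cost l -> exists l1 x l2, l = l1 ++ x :: l2 /\
    chain_cost l1 <= c /\ chain_cost l2 <= chain_cost l - c.
Proof.
  revert c. induction l as [|p l IH]; intros c Hc Hl Hle; [easy|].
  destruct (Rle_lt_dec ((/ 2) ^ fst p) c) as [H|H].
  - destruct l as [|q l].
    + exists [], p, []. simpl in *. split; [easy|]. lra.
    + destruct (IH (c - (/ 2) ^ fst p)) as (l1 & x & l2 & E & H1 & H2);
        [lra | easy | simpl in *; lra |].
      exists (p :: l1), x, l2. split; [now rewrite E|].
      simpl in *. lra.
  - exists [], p, l. simpl in *. split; [easy|]. lra.
Qed.

Section Chains.
Variable V : nat -> G -> Prop.
Hypothesis V_one : forall n, V n 1.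
Hypothesis V_all : forall g, V 0 g.
Hypothesis V_inv : forall n g, V n g -> V n (inv g).
Hypothesis V_conj : forall n g x, V n x -> V n (g * x * inv g).
Hypothesis V_cube : forall n x y z, V (S n) x -> V (S n) y -> V (S n) z -> V n (x * (y * z)).

Definition is_chain (g : G) (l : list (nat * G)) : Prop :=
  Forall (fun p => V (fst p) (snd p)) l /\ chain_prod l = g.

Lemma V_decreasing m n x : (n <= m)%nat -> V m x -> V n x.
Proof.
  induction 1 as [|m Hle IH]; [easy|]. intros Hx. apply IH.
  (* [x] is read as [x * (1 * 1)], to which [V_cube] applies. *)
  rewrite <- (tg_mulg1 x), <- (tg_mul1g G 1). auto.
Qed.

(* Frink's argument: cut a chain of cost [S < 2^-n] at its midpoint into two
   chains of cost at most [S / 2] and one link. *)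
Lemma chain_small g l n : is_chain g l -> chain_cost l < (/ 2) ^ n -> V n g.
Proof.
  remember (length l) as k eqn:Ek. revert g l n Ek.
  induction k as [k IH] using (well_founded_induction lt_wf). intros g l n -> [Hl Hg] Hc. subst g.
  destruct l as [|p l]; [apply V_one|].
  destruct (chain_split (p :: l) (chain_cost (p :: l) / 2)) as (l1 & x & l2 & E & H1 & H2);
    try (pose proof (chain_cost_ge0 (p :: l)); easy || lra).
  rewrite E in *. clear E p l.
  rewrite chain_prod_app. rewrite Forall_app, Forall_cons_iff in Hl.
  rewrite length_app in IH. simpl in *.
  destruct Hl as (Hl1 & Hx & Hl2). rewrite chain_cost_app in *. simpl in *.
  pose proof (chain_cost_ge0 l1). pose proof (chain_cost_ge0 l2).
  pose proof (half_pow_pos (fst x)).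
  (* The outer pieces are shorter chains of cost below 2^-(n+1), so induction puts their products in
     [V (S n)]. The middle link costs less than 2^-n, so its index exceeds [n]. *)
  apply V_cube.
  - apply (IH (length l1) ltac:(lia) _ l1 (S n) eq_refl); [now split | simpl; lra].
  - apply (V_decreasing (fst x)); [|easy]. apply half_pow_lt. lra.
  - apply (IH (length l2) ltac:(lia) _ l2 (S n) eq_refl); [now split | simpl; lra].
Qed.

(** [N g] is the infimum of the costs of chains with product [g]; such chains exist because [V 0] is
    the whole group. The infimum need not be attained, whence the strict bound in the second
    clause. *)
Lemma chain_length_exists : exists N : G -> R,
  (forall g l, is_chain g l -> N g <= chain_cost l) /\
  (forall g c, N g < c -> exists l, is_chain g l /\ chain_cost l < c).
Proof.
  assert (H : forall g, exists m,
    (forall l, is_chain g l -> m <= chain_cost l) /\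
    (forall c, m < c -> exists l, is_chain g l /\ chain_cost l < c)).
  { intros g.
    destruct (glb_exists (fun x => exists l, is_chain g l /\ x = chain_cost l) 0)
      as [m [Hm1 Hm2]].
    - exists (chain_cost [(0%nat, g)]), [(0%nat, g)]. split; [|easy].
      split; [now repeat constructor|]. simpl. apply tg_mulg1.
    - intros x (l & _ & ->). apply chain_cost_ge0.
    - exists m. split; [intros l Hl; apply Hm1; eauto|].
      intros c Hc. apply NNPP. intros Hn. apply (Rlt_not_le _ _ Hc), Hm2.
      intros x (l & Hl & ->). apply Rnot_lt_le. intros Hlt. apply Hn; eauto. }
  exists (fun g => proj1_sig (constructive_indefinite_description _ (H g))).
  split; intros g; destruct (constructive_indefinite_description _ (H g)) as [m Hm];
    apply Hm.
Qed.

Lemma chain_inv g l : is_chain g l ->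
  exists l', is_chain (inv g) l' /\ chain_cost l' = chain_cost l.
Proof.
  intros [Hl <-]. induction Hl as [|p l Hp Hl (l' & [Hl' E] & IH)].
  - exists []. repeat split; auto. simpl. now rewrite tg_inv1.
  - exists (l' ++ [(fst p, inv (snd p))]). rewrite chain_cost_app. simpl.
    split; [|lra]. split.
    + apply Forall_app. split; [easy|]. repeat constructor. simpl. auto.
    + rewrite chain_prod_app, E. simpl. now rewrite tg_mulg1, tg_invM.
Qed.

Lemma chain_conj h g l : is_chain g l ->
  exists l', is_chain (h * g * inv h) l' /\ chain_cost l' = chain_cost l.
Proof.
  intros [Hl <-]. induction Hl as [|p l Hp Hl (l' & [Hl' E] & IH)].
  - exists []. repeat split; auto. simpl. now rewrite tg_mulg1, tg_mulgV.
  - exists ((fst p, h * snd p * inv h) :: l'). simpl. split; [|lra]. split.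
    + constructor; simpl; auto.
    + simpl. now rewrite E, tg_conjM.
Qed.

(** Inverting or conjugating a chain keeps its cost, and concatenation adds costs. The comparison
    with [V n] comes from [chain_small] in one direction and from one-link chains in the other. *)
Lemma invariant_length_of_nbhds : exists N : G -> R,
  N 1 = 0 /\ (forall g, 0 <= N g) /\
  (forall g, N (inv g) = N g) /\
  (forall g h, N (g * h) <= N g + N h) /\
  (forall g h, N (g * h * inv g) = N h) /\
  (forall n g, N g < (/ 2) ^ n -> V n g) /\
  (forall n g, V n g -> N g <= (/ 2) ^ n).
Proof.
  destruct chain_length_exists as (N & HN1 & HN2).
  assert (Hge : forall g, 0 <= N g).
  { intros g. apply Rnot_lt_le. intros H. destruct (HN2 _ _ H) as (l & _ & Hl).
    pose proof (chain_cost_ge0 l). lra. }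
  assert (Hinv : forall g, N (inv g) <= N g).
  { intros g. apply Rnot_lt_le. intros H. destruct (HN2 _ _ H) as (l & Hl & Hc).
    destruct (chain_inv _ _ Hl) as (l' & Hl' & E). specialize (HN1 _ _ Hl'). lra. }
  assert (Hconj : forall h g, N (h * g * inv h) <= N g).
  { intros h g. apply Rnot_lt_le. intros H. destruct (HN2 _ _ H) as (l & Hl & Hc).
    destruct (chain_conj h _ _ Hl) as (l' & Hl' & E). specialize (HN1 _ _ Hl'). lra. }
  exists N. split; [|split; [|split; [|split; [|split; [|split]]]]].
  - apply Rle_antisym; [|auto]. apply (HN1 1 []). now repeat constructor.
  - auto.
  - intros g. apply Rle_antisym; [auto|]. rewrite <- (tg_invK g) at 1. auto.
  (* If subadditivity failed, chains for [g] and [h], each within half of the gap of the infimum,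
     would concatenate to a chain for [g * h] that is too cheap. *)
  - intros g h. apply Rnot_lt_le. intros H.
    destruct (HN2 g (N g + (N (g * h) - (N g + N h)) / 2)) as (l1 & [Hl1 E1] & Hc1); [lra|].
    destruct (HN2 h (N h + (N (g * h) - (N g + N h)) / 2)) as (l2 & [Hl2 E2] & Hc2); [lra|].
    assert (N (g * h) <= chain_cost (l1 ++ l2)).
    { apply HN1. split; [now apply Forall_app|]. now rewrite chain_prod_app, E1, E2. }
    rewrite chain_cost_app in *. lra.
  - intros g h. apply Rle_antisym; [auto|].
    replace h with (inv g * (g * h * inv g) * inv (inv g)) at 1; [auto|].
    now rewrite tg_invK, <- !tg_assoc, tg_mulVg, tg_mulg1, tg_mulKg.
  - intros n g H. destruct (HN2 _ _ H) as (l & Hl & Hc). eauto using chain_small.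
  - intros n g H. replace ((/ 2) ^ n) with (chain_cost [(n, g)]) by (simpl; lra).
    apply HN1. split; [now repeat constructor|]. apply tg_mulg1.
Qed.
End Chains.

(** * Neighbourhoods of the identity and the Birkhoff-Kakutani construction *)

Lemma nbhd_and p (A B : G -> Prop) : nbhd (tg_open G) p A -> nbhd (tg_open G) p B ->
  nbhd (tg_open G) p (fun x => A x /\ B x).
Proof.
  intros (O1 & HO1 & H1 & S1) (O2 & HO2 & H2 & S2).
  exists (fun x => O1 x /\ O2 x). split; [apply (tg_topology G); auto|].
  split; [auto|]. intros x []; auto.
Qed.

Lemma nbhd_one_square W : nbhd (tg_open G) 1 W ->
  exists V, nbhd (tg_open G) 1 V /\ forall x y, V x -> V y -> W (x * y).
Proof.
  intros (O & HO & H1 & HW).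
  destruct (tg_mul_cont G 1 1 O HO) as (A & B & HA & HB & A1 & B1 & HAB);
    [now rewrite tg_mul1g|].
  exists (fun x => A x /\ B x). split.
  - apply nbhd_and; [exists A | exists B]; auto.
  - intros x y [] []. auto.
Qed.

(** Two applications of [nbhd_one_square] control triple products, and SIN then supplies an
    invariant set. Intersecting it with its inverse keeps the invariance, since conjugation commutes
    with inversion. *)
Lemma SIN_nbhd_cube W : SIN_group G -> nbhd (tg_open G) 1 W ->
  exists V, nbhd (tg_open G) 1 V /\ (forall x, V x -> V (inv x)) /\
    (forall g x, V x -> V (g * x * inv g)) /\
    (forall x y z, V x -> V y -> V z -> W (x * (y * z))).
Proof.
  intros HS HW.
  destruct (nbhd_one_square W HW) as (A & HA & HA2).
  destruct (nbhd_one_square A HA) as (B & HB & HB2).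
  destruct (HS _ (nbhd_and _ _ _ HA HB)) as (V & HV & HVW & Hc).
  exists (fun x => V x /\ V (inv x)). split; [|split; [|split]].
  - apply nbhd_and; [easy|]. destruct HV as (O & HO & H1 & HOV).
    exists (fun x => O (inv x)). split; [now apply tg_inv_cont|].
    rewrite tg_inv1. auto.
  - intros x [H1 H2]. rewrite tg_invK. auto.
  - intros g x [H1 H2]. split; [auto|]. rewrite !tg_invM, tg_invK, tg_assoc. auto.
  - intros x y z [Hx _] [Hy _] [Hz _]. apply HA2; [|apply HB2]; apply HVW; auto.
Qed.

Theorem compatible_length_exists :
  metrizable G -> SIN_group G -> exists N : G -> R, compatible_length N.
Proof.
  intros (d & [Hd0 [Hd1 [Hds Hdt]]] & Hop) HS.
  (* Triple products from the next set must lie in the previous set and in the ball of radius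
     1/(n+1). The second demand makes the sets [V n] a neighbourhood base at the identity. *)
  set (next := fun (n : nat) (W : G -> Prop) => epsilon (inhabits W) (fun V =>
     nbhd (tg_open G) 1 V /\ (forall x, V x -> V (inv x)) /\
     (forall g x, V x -> V (g * x * inv g)) /\
     (forall x y z, V x -> V y -> V z ->
        W (x * (y * z)) /\ d 1 (x * (y * z)) < / INR (S n)))).
  set (V := nat_rect (fun _ => G -> Prop) (fun _ => True) next).
  assert (Hball : forall n : nat, nbhd (tg_open G) 1 (fun x => d 1 x < / INR (S n))).
  { intros n. exists (fun x => d 1 x < / INR (S n)). split; [|split; [|auto]].
    - apply Hop. intros x Hx. exists (/ INR (S n) - d 1 x). split; [lra|].
      intros y Hy. specialize (Hdt 1 x y). lra.
    - rewrite (proj2 (Hd1 1 1) eq_refl). apply Rinv_0_lt_compat, lt_0_INR. lia. }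
  assert (Hnb : forall n, nbhd (tg_open G) 1 (V n) ->
     nbhd (tg_open G) 1 (V (S n)) /\ (forall x, V (S n) x -> V (S n) (inv x)) /\
     (forall g x, V (S n) x -> V (S n) (g * x * inv g)) /\
     (forall x y z, V (S n) x -> V (S n) y -> V (S n) z ->
        V n (x * (y * z)) /\ d 1 (x * (y * z)) < / INR (S n))).
  { intros n Hn. change (V (S n)) with (next n (V n)). unfold next.
    apply epsilon_spec. apply (SIN_nbhd_cube (fun x => V n x /\ d 1 x < / INR (S n)) HS).
    now apply nbhd_and. }
  assert (HV : forall n, nbhd (tg_open G) 1 (V n)).
  { induction n as [|n IH]; [|now apply Hnb].
    exists (fun _ => True). repeat split. apply (tg_topology G). }
  assert (V1 : forall n, V n 1).
  { intros n. destruct (HV n) as (O & _ & H1 & H2). auto. }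
  destruct (invariant_length_of_nbhds V) as (N & N1 & N0 & NV & NM & NJ & Nlt & Nle); auto.
  - now intros g.
  - intros [|n] g; [easy|]. apply Hnb, HV.
  - intros [|n] g x; [easy|]. apply Hnb, HV.
  - intros n x y z Hx Hy Hz. now apply Hnb.
  - exists N. split; [|split; [|split; [|split; [|split]]]]; auto.
    assert (Hsmall : forall W, nbhd (tg_open G) 1 W -> exists n, forall x, V n x -> W x).
    { intros W (O & HO & H1 & HW). apply Hop in HO. destruct (HO _ H1) as (e & He & HOe).
      destruct (archimed_cor1 e He) as (n & Hn & Hn0).
      exists n. intros x Hx. apply HW, HOe. destruct n as [|n]; [lia|].
      apply Rlt_trans with (/ INR (S n)); [|easy].
      replace x with (x * (1 * 1)) by now rewrite tg_mul1g, tg_mulg1.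
      now apply (Hnb n (HV n)). }
    intros W. split.
    + intros HW g Hg.
      destruct (tg_mul_cont G g 1 W HW) as (A & B & HA & HB & Ag & B1 & HAB);
        [now rewrite tg_mulg1|].
      destruct (Hsmall B) as (n & Hn); [exists B; auto|].
      exists ((/ 2) ^ n). split; [apply half_pow_pos|]. intros h Hh.
      rewrite <- (tg_mulVKg g h). auto.
    + intros H.
      (* Openness is obtained from the union axiom: [W] is the union of its open subsets. *)
      assert (E : W = fun x => exists S, (tg_open G S /\ forall y, S y -> W y) /\ S x).
      { apply functional_extensionality. intros x. apply propositional_extensionality. split; [|firstorder].
        intros Hx. destruct (H x Hx) as (e & He & HWe).
        destruct (pow_lt_1_zero (/ 2) ltac:(rewrite Rabs_pos_eq; lra) e He) as [n Hn].
        specialize (Hn n (le_n n)). rewrite Rabs_pos_eq in Hn by (pose proof (half_pow_pos n); lra).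
        destruct (HV n) as (O & HO & H1 & HOV).
        (* Continuity at [(inv x, x)] gives a neighbourhood [B] of [x] on which [inv x * y] stays in
           [V n], hence has length at most 2^-n < e. *)
        destruct (tg_mul_cont G (inv x) x O HO) as (A & B & HA & HB & Ax & Bx & HAB);
          [now rewrite tg_mulVg|].
        exists B. split; [split; [easy|]|easy]. intros y Hy.
        apply HWe. apply Rle_lt_trans with ((/ 2) ^ n); [|easy]. apply Nle, HOV; auto. }
      rewrite E. apply (tg_topology G). now intros S [].
Qed.
End Group.

(** * Cardinal arithmetic below [M] *)

Lemma card_le_trans A B C : card_le A B -> card_le B C -> card_le A C.
Proof.
  intros [f Hf] [g Hg]. exists (fun x => g (f x)). intros x y H. apply Hf, Hg, H.
Qed.

Lemma proj1_sig_injective {A : Type} (P : A -> Prop) (x y : {a | P a}) :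
  proj1_sig x = proj1_sig y -> x = y.
Proof. destruct x, y. simpl. intros ->. f_equal. apply proof_irrelevance. Qed.

Lemma card_le_prod A B C D : card_le A B -> card_le C D -> card_le (A * C) (B * D).
Proof.
  intros [f Hf] [g Hg]. exists (fun p => (f (fst p), g (snd p))).
  intros [x y] [x' y'] H. simpl in H. injection H as H1 H2.
  now rewrite (Hf _ _ H1), (Hg _ _ H2).
Qed.

Lemma card_le_fun I A B : card_le A B -> card_le (I -> A) (I -> B).
Proof.
  intros [f Hf]. exists (fun t i => f (t i)). intros t t' H.
  apply functional_extensionality. intros i. apply Hf. exact (equal_f H i).
Qed.

Lemma card_le_surj A B (f : A -> B) : surjective f -> card_le B A.
Proof.
  intros Hf. exists (fun y => proj1_sig (constructive_indefinite_description _ (Hf y))).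
  intros x y H.
  rewrite <- (proj2_sig (constructive_indefinite_description _ (Hf x))), H.
  apply proj2_sig.
Qed.

Lemma card_le_inv_surj A B : card_le A B -> A -> exists g : B -> A, surjective g.
Proof.
  intros [f Hf] a0. exists (fun y => epsilon (inhabits a0) (fun x => f x = y)).
  intros x. exists (f x). apply Hf, epsilon_spec. now exists x.
Qed.

(** No list exhausts [M], since positions in it would inject [M] into [nat]; so a fresh element can
    be added to the list again and again. *)
Lemma uncountable_nat_le M : uncountable M -> card_le nat M.
Proof.
  intros HM.
  assert (Hfresh : forall l : list M, exists x, ~ In x l).
  { intros l. apply NNPP. intros Hn.
    assert (Hall : forall x, exists n, nth_error l n = Some x).
    { intros x. apply In_nth_error. apply NNPP. eauto. }
    apply HM.
    exists (fun x => proj1_sig (constructive_indefinite_description _ (Hall x))).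
    intros x y E.
    destruct (constructive_indefinite_description _ (Hall x)) as [n Hx].
    destruct (constructive_indefinite_description _ (Hall y)) as [m Hy].
    simpl in E. congruence. }
  set (fresh := fun l => proj1_sig (constructive_indefinite_description _ (Hfresh l))).
  assert (Hf : forall l, ~ In (fresh l) l) by (intros l; apply proj2_sig).
  set (seqs := nat_rect (fun _ => list M) [] (fun _ l => fresh l :: l)).
  assert (Hin : forall m n, (m < n)%nat -> In (fresh (seqs m)) (seqs n)).
  { intros m n Hmn. induction Hmn; simpl; auto. }
  exists (fun n => fresh (seqs n)). intros m n E.
  destruct (Nat.lt_total m n) as [H|[H|H]]; [|easy|]; exfalso.
  - apply (Hf (seqs n)). rewrite <- E. auto.
  - apply (Hf (seqs m)). rewrite E. auto.
Qed.

(** A real [x] is determined by the integers [up (x * INR n)]: distinct reals differ by more than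
    1/n for some [n]. [code] sends nonnegative integers to even numbers and negative ones to odd
    numbers. *)
Lemma card_le_R_nat_fun : card_le R (nat -> nat).
Proof.
  set (code := fun z : Z => if Z_le_dec 0 z then Z.to_nat (2 * z) else Z.to_nat (- 2 * z + 1)).
  exists (fun x n => code (up (x * INR n))). intros x y E.
  assert (H : forall n, up (x * INR n) = up (y * INR n)).
  { intros n. apply (f_equal (fun f => f n)) in E. unfold code in E.
    destruct (Z_le_dec 0 _), (Z_le_dec 0 _); lia. }
  apply NNPP. intros Hxy.
  assert (Hd : 0 < Rabs (x - y)) by (apply Rabs_pos_lt; lra).
  destruct (archimed_cor1 _ Hd) as (n & Hn & Hn0).
  pose proof (archimed (x * INR n)) as Hx. pose proof (archimed (y * INR n)) as Hy.
  rewrite H in Hx.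
  assert (Hpos : 0 < INR n) by now apply lt_0_INR.
  assert (1 < Rabs (x - y) * INR n).
  { apply (Rmult_lt_compat_r (INR n)) in Hn; [|easy]. rewrite Rinv_l in Hn; lra. }
  destruct (Rcase_abs (x - y)) as [Hs|Hs];
    [rewrite (Rabs_left _ Hs) in * | rewrite (Rabs_right _ Hs) in *]; lra.
Qed.

Definition powers_below_le (M : Type) : Prop :=
  forall N : Type, card_lt N M -> card_le (N -> M) M.

Section Powers.
Variable M : Type.
Hypothesis HM : uncountable M.
Hypothesis Hpow : powers_below_le M.

Lemma card_lt_countable A : card_le A nat -> card_lt A M.
Proof.
  intros HA. split.
  - exact (card_le_trans _ _ _ HA (uncountable_nat_le M HM)).
  - intros H. exact (HM (card_le_trans _ _ _ H HA)).
Qed.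

Lemma card_le_sequences A : card_le A M -> card_le (nat -> A) M.
Proof.
  intros HA. apply (card_le_trans _ (nat -> M)); [now apply card_le_fun|].
  apply Hpow, card_lt_countable. now exists (fun n => n).
Qed.

(** A pair is a function on [bool], so the bound on products is an instance of the bound on
    powers. *)
Lemma card_le_pairs A B : card_le A M -> card_le B M -> card_le (A * B) M.
Proof.
  intros HA HB. apply (card_le_trans _ (M * M)); [now apply card_le_prod|].
  apply (card_le_trans _ (bool -> M)).
  - exists (fun p b => if b : bool then fst p else snd p). intros [x y] [x' y'] E.
    pose proof (equal_f E true) as E1. pose proof (equal_f E false) as E2.
    simpl in *. congruence.
  - apply Hpow, card_lt_countable. exists (fun b : bool => if b then 0%nat else 1%nat).
    now intros [] [].
Qed.

Lemma card_le_reals : card_le R M.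
Proof.
  apply (card_le_trans _ _ _ card_le_R_nat_fun), card_le_sequences, uncountable_nat_le, HM.
Qed.

Lemma card_le_option A : card_le A M -> card_le (option A) M.
Proof.
  intros [f Hf]. destruct (uncountable_nat_le M HM) as [e He].
  apply (card_le_trans _ (M * M)).
  - exists (fun o => match o with Some a => (f a, e 0%nat) | None => (e 0%nat, e 1%nat) end).
    intros [a|] [b|] E; [| | |easy]; injection E; intros.
    + now rewrite (Hf a b).
    + now specialize (He 0%nat 1%nat ltac:(auto)).
    + now specialize (He 1%nat 0%nat ltac:(auto)).
  - apply card_le_pairs; now exists (fun x => x).
Qed.

(** Under an injection of [M * bool] into [M], the point [a] is hit by at most one of the two copies
    of [M]; the other copy avoids it. *)
Lemma card_le_remove_point (a : M) : card_le M {x | x <> a}.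
Proof.
  destruct (card_le_pairs M (bool : Type)) as [j Hj].
  - now exists (fun x => x).
  - apply card_lt_countable. exists (fun b : bool => if b then 0%nat else 1%nat).
    now intros [] [].
  - assert (Hb : exists b, forall x, j (x, b) <> a).
    { apply NNPP. intros Hn. 
      assert (H : forall b, exists x, j (x, b) = a).
      { intros b. apply NNPP. intros H. apply Hn. exists b. eauto. }
      destruct (H true) as [x Hx], (H false) as [y Hy].
      rewrite <- Hy in Hx. apply Hj in Hx. congruence. }
    destruct Hb as [b Hb]. exists (fun x => exist _ (j (x, b)) (Hb x)).
    intros x y E. apply (f_equal (@proj1_sig _ _)) in E. simpl in E.
    apply Hj in E. congruence.
Qed.
End Powers.

(** * Initial well-orders and regularity *)

Definition segment {M : Type} (lt : M -> M -> Prop) (a : M) : Type := {b | lt b a}.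

Definition initial_order {M : Type} (lt : M -> M -> Prop) : Prop :=
  strict_well_order lt /\ forall a, ~ card_le M (segment lt a).

(** If some segment is as large as [M], the order is pulled back along an injection of [M] into the
    least such segment. Segments of the new order inject into strictly smaller segments of the old
    one. *)
Lemma initial_order_exists (M : Type) : exists lt : M -> M -> Prop, initial_order lt.
Proof.
  destruct (strict_well_order_exists M) as [lt Hlt].
  destruct (classic (exists a, card_le M (segment lt a))) as [[a0 Ha0]|Hn].
  2: { exists lt. split; [easy|]. intros a Ha. eauto. }
  destruct Hlt as (Hwf & Htr & Htot).
  assert (Hleast : exists a, card_le M (segment lt a) /\
    forall b, lt b a -> ~ card_le M (segment lt b)).
  { revert Ha0. induction a0 as [a IH] using (well_founded_ind Hwf). intros Ha.
    destruct (classic (exists b, lt b a /\ card_le M (segment lt b))) as [(b & Hb & Hc)|Hn].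
    - exact (IH b Hb Hc).
    - exists a. split; [easy|]. intros b Hb Hc. eauto. }
  destruct Hleast as (a & [f Hf] & Hmin).
  exists (fun b c => lt (proj1_sig (f b)) (proj1_sig (f c))).
  split; [split; [|split]|].
  - apply (wf_inverse_image M M lt (fun b => proj1_sig (f b)) Hwf).
  - eauto.
  - intros b c. destruct (Htot (proj1_sig (f b)) (proj1_sig (f c))) as [H|[H|H]]; auto.
    right; left. now apply Hf, proj1_sig_injective.
  - intros c [h Hh]. apply (Hmin (proj1_sig (f c)) (proj2_sig (f c))).
    exists (fun x => exist _ (proj1_sig (f (proj1_sig (h x)))) (proj2_sig (h x))).
    intros x y E. apply (f_equal (@proj1_sig _ _)) in E. simpl in E.
    now apply Hh, proj1_sig_injective, Hf, proj1_sig_injective.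
Qed.

Section InitialOrder.
Variable M : Type.
Variable lt : M -> M -> Prop.
Hypothesis HM : uncountable M.
Hypothesis Hpow : powers_below_le M.
Hypothesis Hlt : initial_order lt.

Lemma segment_card_lt a : card_lt (segment lt a) M.
Proof.
  split; [|apply Hlt]. exists (@proj1_sig _ _). intros x y. apply proj1_sig_injective.
Qed.

Lemma unbounded_image (f : M -> M) (a : M) : injective f -> exists x, ~ lt (f x) a.
Proof.
  intros Hf. apply NNPP. intros Hn. apply (proj2 Hlt a).
  assert (H : forall x, lt (f x) a) by (intros x; apply NNPP; eauto).
  exists (fun x => exist _ (f x) (H x)). intros x y E. apply Hf.
  exact (f_equal (@proj1_sig _ _) E).
Qed.

(** The segment below a maximum would be [M] without one point, which is still as large as [M]. *)
Lemma no_maximum a : exists b, lt a b.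
Proof.
  destruct Hlt as ((Hwf & Htr & Htot) & Hseg).
  apply NNPP. intros Hn. apply (Hseg a).
  apply (card_le_trans _ _ _ (card_le_remove_point M HM Hpow a)).
  assert (H : forall x, x <> a -> lt x a).
  { intros x Hx. destruct (Htot x a) as [|[|]]; [easy|easy|]. exfalso; eauto. }
  exists (fun x => exist _ (proj1_sig x) (H _ (proj2_sig x))).
  intros x y E. apply (f_equal (@proj1_sig _ _)) in E. now apply proj1_sig_injective.
Qed.

(* Koenig's diagonal argument: a cofinal [t] would give [M < (segment lt a -> M)]. *)
Lemma initial_order_regular a (t : segment lt a -> M) : exists c, forall i, lt (t i) c.
Proof.
  destruct Hlt as ((Hwf & Htr & Htot) & Hseg).
  apply NNPP. intros Hn.
  destruct (card_le_inv_surj (segment lt a -> M) M (Hpow _ (segment_card_lt a)) t) as [s Hs].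
  (* The indices [c] up to [t i] lie in a segment, too small for the values [s c i] to exhaust [M].
     A function that picks a missed value at each [i] equals some [s c], and this [c] must exceed
     every [t i]. *)
  assert (Hdiag : forall i, exists y, forall c, lt c (t i) \/ c = t i -> s c i <> y).
  { intros i. destruct (no_maximum (t i)) as [b Hb].
    apply NNPP. intros Hall. apply (Hseg b).
    apply (card_le_surj _ _ (fun c : segment lt b => s (proj1_sig c) i)).
    intros y. apply NNPP. intros Hy. apply Hall. exists y. intros c Hc E. apply Hy.
    assert (Hcb : lt c b) by (destruct Hc as [Hc| ->]; eauto).
    now exists (exist _ c Hcb). }
  destruct (Hs (fun i => proj1_sig (constructive_indefinite_description _ (Hdiag i))))
    as [c Hc].
  apply Hn. destruct (no_maximum c) as [c' Hc']. exists c'. intros i.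
  destruct (Htot (t i) c) as [H|[H|H]]; [eauto| |]; exfalso;
    apply (proj2_sig (constructive_indefinite_description _ (Hdiag i)) c);
    auto; exact (equal_f Hc i).
Qed.
End InitialOrder.

(** * Cardinality of metric spaces from weight and density *)

Lemma weight_le_card (T : Type) (d : T -> T -> R) (opn : (T -> Prop) -> Prop) (M : Type) :
  uncountable M -> powers_below_le M ->
  is_metric d -> (forall S, opn S <-> mopen d S) -> weight_le opn M -> card_le T M.
Proof.
  intros HM Hpow (Hd0 & Hd1 & Hds & Hdt) Hop (I & B & HI & HB & Hbase).
  (* A point is coded by the indices of basic sets that contain it and lie in its balls of radius
     1/(n+1). *)
  apply (card_le_trans _ (nat -> I)); [|now apply card_le_sequences].
  assert (H : forall x (n : nat), exists i, B i x /\ forall y, B i y -> d x y < / INR (S n)).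
  { intros x n. apply (Hbase (fun y => d x y < / INR (S n)) x).
    - apply Hop. intros y Hy. exists (/ INR (S n) - d x y). split; [lra|].
      intros z Hz. specialize (Hdt x y z). lra.
    - rewrite (proj2 (Hd1 x x) eq_refl). apply Rinv_0_lt_compat, lt_0_INR. lia. }
  exists (fun x n => proj1_sig (constructive_indefinite_description _ (H x n))).
  intros x y E. apply Hd1, NNPP. intros Hn.
  destruct (archimed_cor1 (d x y)) as (n & Hn1 & Hn2); [specialize (Hd0 x y); lra|].
  destruct n as [|n]; [lia|]. apply (f_equal (fun f => f n)) in E.
  destruct (constructive_indefinite_description _ (H x n)) as [i Hi].
  destruct (constructive_indefinite_description _ (H y n)) as [j Hj].
  simpl in E. subst j. destruct Hi as [_ Hi], Hj as [Hj _].
  specialize (Hi _ Hj). lra.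
Qed.

Lemma density_le_card (X : MetricSpace) (D : X -> Prop) (M : Type) :
  uncountable M -> powers_below_le M ->
  dense X D -> card_le {x | D x} M -> card_le X M.
Proof.
  intros HM Hpow HD HDM. destruct (ms_metric X) as (Hd0 & Hd1 & Hds & Hdt).
  apply (card_le_trans _ (nat -> {x | D x})); [|now apply card_le_sequences].
  assert (H : forall x (n : nat), exists y : {y | D y}, ms_d x (proj1_sig y) < / INR (S n)).
  { intros x n. destruct (HD x (/ INR (S n))) as (y & Hy & Hxy).
    - apply Rinv_0_lt_compat, lt_0_INR. lia.
    - now exists (exist _ y Hy). }
  exists (fun x n => proj1_sig (constructive_indefinite_description _ (H x n))).
  intros x y E. apply Hd1, NNPP. intros Hn.
  destruct (archimed_cor1 (ms_d x y / 2)) as (n & Hn1 & Hn2);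
    [specialize (Hd0 x y); lra|].
  destruct n as [|n]; [lia|]. apply (f_equal (fun f => f n)) in E.
  destruct (constructive_indefinite_description _ (H x n)) as [i Hi].
  destruct (constructive_indefinite_description _ (H y n)) as [j Hj].
  simpl in E. subst j. specialize (Hdt x (proj1_sig i) y). rewrite (Hds (proj1_sig i) y) in Hdt. lra.
Qed.

(** * The tower of Katetov extensions *)

(** [Q] may look only at earlier values, so the partial function can be completed by the default
    [a0] before a value is chosen. The conclusion is conditional because a witness at [s] may exist
    only thanks to the properties of the earlier values, which are proved afterwards by
    induction. *)
Lemma wf_choice (S A : Type) (lt : S -> S -> Prop) (a0 : A) (Q : S -> (S -> A) -> A -> Prop) :
  well_founded lt ->
  (forall s f f' y, (forall s', lt s' s -> f s' = f' s') -> Q s f y -> Q s f' y) ->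
  exists f : S -> A, forall s, (exists y, Q s f y) -> Q s f (f s).
Proof.
  intros Hwf Hloc.
  set (ext := fun s (rec : forall s', lt s' s -> A) s' =>
    match excluded_middle_informative (lt s' s) with left h => rec s' h | right _ => a0 end).
  set (F := fun s rec => epsilon (inhabits a0) (Q s (ext s rec))).
  set (f := Fix Hwf (fun _ => A) F).
  assert (Hf : forall s, f s = F s (fun s' _ => f s')).
  { intros s. apply (Fix_eq Hwf (fun _ => A) F). intros x g h Hgh. f_equal.
    apply functional_extensionality_dep. intros y.
    apply functional_extensionality_dep. intros p. apply Hgh. }
  assert (Hext : forall s s', lt s' s -> ext s (fun s' _ => f s') s' = f s').
  { intros s s' H. unfold ext. now destruct (excluded_middle_informative _). }
  exists f. intros s [y Hy].
  apply (Hloc s (ext s (fun s' _ => f s'))); [apply Hext|].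
  rewrite Hf. apply epsilon_spec. exists y.
  apply (Hloc s f); [|easy]. intros s' Hs'. now rewrite Hext.
Qed.

(** * Katetov functions and their extension *)

Lemma Rabs_le_between x c : Rabs x <= c -> - c <= x <= c.
Proof. pose proof (Rle_abs x). pose proof (Rle_abs (- x)). rewrite Rabs_Ropp in *. lra. Qed.

Definition katetov_on {X : Type} (P : X -> Prop) (D : X -> X -> R) (k : X -> R) : Prop :=
  forall x y, P x -> P y -> k x <= k y + D x y /\ D x y <= k x + k y.

(** The family form allows [t] to repeat points and lets segments serve as index sets. For a
    pseudometric, points at distance zero are forced to have equal prescribed values. *)
Definition katetov_family {X I : Type} (D : X -> X -> R) (t : I -> X) (r : I -> R) : Prop :=
  forall i j, r i <= r j + D (t i) (t j) /\ D (t i) (t j) <= r i + r j.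

(** The extension is [k x], the infimum over [i] of [r i + D (t i) x]. *)
Lemma katetov_extension {X I : Type} (P : X -> Prop) (D : X -> X -> R) (t : I -> X) (r : I -> R) :
  (forall x, P x -> D x x = 0) ->
  (forall x y, P x -> P y -> D x y = D y x) ->
  (forall x y z, P x -> P y -> P z -> D x z <= D x y + D y z) ->
  inhabited I -> (forall i, P (t i)) -> katetov_family D t r ->
  exists k, katetov_on P D k /\ forall i, k (t i) = r i.
Proof.
  intros D0 Ds Dt [i0] Pt Hr.
  assert (r0 : forall i, 0 <= r i).
  { intros i. destruct (Hr i i) as [_ H]. rewrite D0 in H by auto. lra. }
  assert (Dpos : forall x y, P x -> P y -> 0 <= D x y).
  { intros x y Hx Hy. specialize (Dt x y x Hx Hy Hx). rewrite D0, (Ds y x) in Dt by auto. lra. }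
  assert (H : forall x, exists m, P x -> (forall i, m <= r i + D (t i) x) /\
      forall c, (forall i, c <= r i + D (t i) x) -> c <= m).
  { intros x. destruct (classic (P x)) as [Hx|Hx]; [|now exists 0].
    destruct (glb_exists (fun v => exists i, v = r i + D (t i) x) 0) as [m [H1 H2]].
    - now exists (r i0 + D (t i0) x), i0.
    - intros v [i ->]. specialize (r0 i). specialize (Dpos (t i) x (Pt i) Hx). lra.
    - exists m. intros _. split; [intros i; apply H1; now exists i|]. intros c Hc. apply H2. intros v [i ->]. auto. }
  set (k := fun x => proj1_sig (constructive_indefinite_description _ (H x))).
  assert (Hk : forall x, P x -> (forall i, k x <= r i + D (t i) x) /\
      forall c, (forall i, c <= r i + D (t i) x) -> c <= k x).
  { intros x. apply (proj2_sig (constructive_indefinite_description _ (H x))). }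
  clearbody k. exists k. split.
  - intros x y Hx Hy. destruct (Hk x Hx) as [Kx1 Kx2], (Hk y Hy) as [Ky1 Ky2]. split.
    + enough (k x - D x y <= k y) by lra. apply Ky2. intros i.
      specialize (Kx1 i). specialize (Dt (t i) y x (Pt i) Hy Hx). rewrite (Ds y x) in Dt; auto. lra.
    + enough (D x y - k y <= k x) by lra. apply Kx2. intros i.
      enough (D x y - (r i + D (t i) x) <= k y) by lra. apply Ky2. intros j.
      destruct (Hr i j) as [_ Hij].
      pose proof (Dt x (t i) y Hx (Pt i) Hy). pose proof (Dt (t i) (t j) y (Pt i) (Pt j) Hy).
      rewrite (Ds x (t i)) in *; auto. lra.
  - intros i. destruct (Hk (t i) (Pt i)) as [K1 K2]. apply Rle_antisym.
    + specialize (K1 i). rewrite D0 in K1; auto. lra.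
    + apply K2. intros j. specialize (Hr i j). rewrite (Ds (t j) (t i)); auto. lra.
Qed.

Definition Rsup (E : R -> Prop) : R := epsilon (inhabits 0) (is_lub E).

Lemma Rsup_lub E c : (exists x, E x) -> (forall x, E x -> x <= c) -> is_lub E (Rsup E).
Proof.
  intros Hne Hc. unfold Rsup. apply epsilon_spec.
  destruct (completeness E) as [m Hm]; [now exists c | easy | eauto].
Qed.

Section Tower.
Variable M : Type.
Variable lt : M -> M -> Prop.
Hypothesis lt_wf : well_founded lt.
Hypothesis lt_trans : forall x y z, lt x y -> lt y z -> lt x z.
Hypothesis lt_total : forall x y, lt x y \/ x = y \/ lt y x.
Variable b0 : M.
Hypothesis b0_least : forall b, ~ lt b b0.
Variable G : TopGroup.
Variable N : G -> R.
Hypothesis HN : compatible_length G N.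
Local Notation "x * y" := (tg_mul G x y).
Local Notation "1" := (tg_one G).
Local Notation inv := (tg_inv G).

(** The pair [(a, g)] is the translate by [g] of the generator adjoined at stage [a]. The carrier is
    fixed in advance, and the recursion only determines a pseudometric on it, where distinct points
    may be at distance zero. *)
Definition point : Type := (M * tg_car G)%type.
Definition act (g : G) (x : point) : point := (fst x, g * snd x).

(** A candidate Katetov family on fewer than [M] points. The component [a] fixes only the index set,
    not the stage at which the task is treated. *)
Definition task : Type := {a : M & ((segment lt a -> point) * (segment lt a -> R))%type}.
Variable e : M -> option task.

Lemma act_act g h x : act g (act h x) = act (g * h) x.
Proof. unfold act; simpl. now rewrite tg_assoc. Qed.

Lemma act_one x : act 1 x = x.
Proof. unfold act. rewrite tg_mul1g. now destruct x. Qed.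

Lemma act_invl g x : act (inv g) (act g x) = x.
Proof. now rewrite act_act, tg_mulVg, act_one. Qed.

Lemma lt_irrefl a : ~ lt a a.
Proof. induction a as [a IH] using (well_founded_ind lt_wf). intros H. exact (IH a H H). Qed.

Lemma lt_asym a b : lt a b -> ~ lt b a.
Proof. intros H1 H2. exact (lt_irrefl a (lt_trans _ _ _ H1 H2)). Qed.

Definition below (a : M) (x : point) : Prop := lt (fst x) a.
Definition upto (a : M) (x : point) : Prop := lt (fst x) a \/ fst x = a.

(* [k a] prescribes the distances from the point [(a, 1)] to the points of
   lower stage; the orbit of [(a, 1)] carries the uniform distance between the
   translates of [k a]. *)
Definition orbit_dist (K : point -> R) (a : M) (g h : G) : R :=
  if excluded_middle_informative (a = b0) then N (inv g * h)
  else Rsup (fun v => exists x, below a x /\ v = Rabs (K (act (inv g) x) - K (act (inv h) x))).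

(** Invariance forces the formula: the distance from [(a, g)] to a lower point [x] must be that from
    [(a, 1)] to [act (inv g) x]. *)
Definition dist (k : M -> point -> R) (x y : point) : R :=
  if excluded_middle_informative (lt (fst x) (fst y)) then k (fst y) (act (inv (snd y)) x)
  else if excluded_middle_informative (lt (fst y) (fst x)) then k (fst x) (act (inv (snd x)) y)
  else orbit_dist (k (fst x)) (fst x) (snd x) (snd y).

Lemma dist_local k k' a x y : (forall b, lt b a -> k b = k' b) ->
  below a x -> below a y -> dist k x y = dist k' x y.
Proof. intros H Hx Hy. unfold dist. now rewrite (H _ Hx), (H _ Hy). Qed.

Lemma dist_gt k a g x : below a x -> dist k (a, g) x = k a (act (inv g) x).
Proof.
  intros H. unfold dist. simpl.
  destruct (excluded_middle_informative _) as [H1|_]; [now destruct (lt_asym _ _ H H1)|].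
  now destruct (excluded_middle_informative _).
Qed.

Lemma dist_lt k a g x : below a x -> dist k x (a, g) = k a (act (inv g) x).
Proof. intros H. unfold dist. simpl. now destruct (excluded_middle_informative _). Qed.

Lemma dist_eq k a g h : dist k (a, g) (a, h) = orbit_dist (k a) a g h.
Proof.
  unfold dist. simpl.
  destruct (excluded_middle_informative _) as [H1|_]; [now destruct (lt_irrefl _ H1)|easy].
Qed.

Definition displacement_space (P : point -> Prop) (D : point -> point -> R) : Prop :=
  (forall x, P x -> D x x = 0) /\
  (forall x y, P x -> P y -> D x y = D y x) /\
  (forall x y z, P x -> P y -> P z -> D x z <= D x y + D y z) /\
  (forall g x y, P x -> P y -> D (act g x) (act g y) = D x y) /\
  (forall g x, P x -> D (act g x) x <= N g).

(** Tasks are listed before any distance is known, so a task that names points not yet built, or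
    whose values are not Katetov for the distance found, imposes nothing. *)
Definition solves_task (a : M) (D : point -> point -> R) (K : point -> R) (o : option task) : Prop :=
  match o with
  | None => True
  | Some (existT c (t, r)) =>
      (forall i, below a (t i)) -> katetov_family D t r -> forall i, K (t i) = r i
  end.

Definition stage_spec (a : M) (k : M -> point -> R) (K : point -> R) : Prop :=
  katetov_on (below a) (dist k) K /\ solves_task a (dist k) K (e a).

Lemma stage_spec_local a k k' K : (forall b, lt b a -> k b = k' b) ->
  stage_spec a k K -> stage_spec a k' K.
Proof.
  intros H [H1 H2]. split.
  - intros x y Hx Hy. rewrite <- (dist_local k k' a); auto.
  - unfold solves_task in *. destruct (e a) as [[c [t r]]|]; [|easy]. intros Ht Hr.
    apply H2; [easy|]. intros i j. rewrite (dist_local k k' a); auto.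
Qed.

(** A meaningful task is solved by [katetov_extension]. Otherwise the distance from [(b0, 1)] is a
    Katetov function, and at [b0] itself there are no lower points to constrain the choice. *)
Lemma stage_exists a k : displacement_space (below a) (dist k) -> exists K, stage_spec a k K.
Proof.
  intros (D0 & Ds & Dt & _).
  assert (Hdef : exists K, katetov_on (below a) (dist k) K).
  { destruct (classic (a = b0)) as [-> | Ha].
    - exists (fun _ => 0). intros x y Hx. now destruct (b0_least _ Hx).
    - assert (Hb : below a (b0, 1)).
      { destruct (lt_total b0 a) as [H|[H|H]]; [easy | now destruct Ha | now destruct (b0_least a)]. }
      exists (dist k (b0, 1)). intros x y Hx Hy. split.
      + rewrite (Ds x y) by auto. auto.
      + rewrite (Ds (b0, 1) x) by auto. auto. }
  unfold stage_spec, solves_task. destruct (e a) as [[c [t r]]|].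
  - destruct (classic ((forall i, below a (t i)) /\ katetov_family (dist k) t r /\
        inhabited (segment lt c))) as [(Ht & Hr & Hi)|Hn].
    + destruct (katetov_extension (below a) (dist k) t r) as [K [H1 H2]]; auto.
      exists K. auto.
    + destruct Hdef as [K HK]. exists K. split; [easy|]. intros Ht Hr i. exfalso.
      apply Hn. repeat split; auto; apply Hr.
  - destruct Hdef as [K HK]. now exists K.
Qed.

Lemma below_act a g x : below a x -> below a (act g x).
Proof. easy. Qed.

(** The last two properties are the triangle inequalities for two points of the new orbit and one
    lower point. The displacement bound passes to the orbit because [K] is 1-Lipschitz. *)
Lemma orbit_dist_spec a (D : point -> point -> R) (K : point -> R) :
  displacement_space (below a) D -> katetov_on (below a) D K ->
  let s := orbit_dist K a in
  (forall g, s g g = 0) /\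
  (forall g h, s g h = s h g) /\
  (forall g h l, s g l <= s g h + s h l) /\
  (forall l g h, s (l * g) (l * h) = s g h) /\
  (forall l g, s (l * g) g <= N l) /\
  (forall g h x, below a x -> Rabs (K (act (inv g) x) - K (act (inv h) x)) <= s g h) /\
  (forall g h x, below a x -> s g h <= K (act (inv g) x) + K (act (inv h) x)).
Proof.
  intros (D0 & Ds & Dt & Di & Dd) HK s.
  destruct HN as (N1 & N0 & NV & NM & NJ & _).
  destruct (classic (a = b0)) as [Ea|Ha].
  - assert (E : forall g h, s g h = N (inv g * h)).
    { intros g h. unfold s, orbit_dist. now destruct (excluded_middle_informative _). }
    assert (Hno : forall x, ~ below a x) by (intros x; rewrite Ea; apply b0_least).
    clearbody s. repeat split; intros; rewrite ?E; try (now destruct (Hno x)).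
    + now rewrite tg_mulVg.
    + rewrite <- NV. f_equal. now rewrite tg_invM, tg_invK.
    + eapply Rle_trans; [|apply NM]. right. f_equal. now rewrite <- tg_assoc, tg_mulVKg.
    + f_equal. now rewrite tg_invM, <- tg_assoc, tg_mulKg.
    (* Conjugation invariance of the length enters here: the displacement of [g] by [l] is the
       length of a conjugate of [inv l]. *)
    + rewrite tg_invM. rewrite <- (tg_invK G g) at 2. rewrite NJ, NV. lra.
  - assert (Hb : below a (b0, 1)).
    { destruct (lt_total b0 a) as [H|[H|H]]; [easy | now destruct Ha | now destruct (b0_least a)]. }
    assert (HKD : forall x y, below a x -> below a y -> Rabs (K x - K y) <= D x y).
    { intros x y Hx Hy. pose proof (HK x y Hx Hy). pose proof (HK y x Hy Hx).
      rewrite (Ds y x) in *; auto. apply Rabs_le. lra. }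
    assert (Hlub : forall g h, is_lub (fun v => exists x, below a x /\
        v = Rabs (K (act (inv g) x) - K (act (inv h) x))) (s g h)).
    { intros g h. unfold s, orbit_dist. destruct (excluded_middle_informative _); [easy|].
      (* The supremum is finite: moving both arguments by [h] leaves a displacement of [x] by
         [h * inv g]. *)
      apply Rsup_lub with (N (h * inv g)); [now exists (Rabs (K (act (inv g) (b0, 1)) - K (act (inv h) (b0, 1)))), (b0, 1)|].
      intros v (x & Hx & ->).
      eapply Rle_trans; [apply HKD; now apply below_act|].
      rewrite <- (Di h) by now apply below_act. rewrite !act_act, tg_mulgV, act_one. auto. }
    assert (Hup : forall g h x, below a x ->
        Rabs (K (act (inv g) x) - K (act (inv h) x)) <= s g h).
    { intros g h x Hx. apply (Hlub g h). now exists x. }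
    assert (Hleast : forall g h c, (forall x, below a x ->
        Rabs (K (act (inv g) x) - K (act (inv h) x)) <= c) -> s g h <= c).
    { intros g h c Hc. apply (Hlub g h). intros v (x & Hx & ->). auto. }
    clearbody s. clear Hlub.
    assert (Hpos : forall g h, 0 <= s g h).
    { intros g h. eapply Rle_trans; [apply Rabs_pos | apply (Hup g h _ Hb)]. }
    assert (Hinv : forall l g h, s (l * g) (l * h) <= s g h).
    { intros l g h. apply Hleast. intros x Hx. rewrite !tg_invM, <- !act_act. now apply Hup. }
    split; [|split; [|split; [|split; [|split; [|split]]]]].
    + intros g. apply Rle_antisym; [|auto]. apply Hleast. intros x Hx.
      rewrite Rminus_diag, Rabs_R0. lra.
    + intros g h. apply Rle_antisym; apply Hleast; intros x Hx; rewrite Rabs_minus_sym; auto.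
    + intros g h l. apply Hleast. intros x Hx.
      eapply Rle_trans; [|apply Rplus_le_compat; apply (Hup _ _ x Hx)].
      eapply Rle_trans; [|apply Rabs_triang]. right. f_equal. ring.
    + intros l g h. apply Rle_antisym; [auto|].
      rewrite <- (tg_mulKg G l g), <- (tg_mulKg G l h) at 1. auto.
    + intros l g. apply Hleast. intros x Hx.
      eapply Rle_trans; [apply HKD; now apply below_act|].
      rewrite tg_invM, <- act_act, Di by now try apply below_act.
      rewrite <- NV. auto.
    + auto.
    (* Each difference of values at [y] is bounded by combining the Lipschitz inequality for one
       translate with the bound on the distance between [x] and [y] through the other. *)
    + intros g h x Hx. apply Hleast. intros y Hy.
      assert (Hax : forall g, below a (act g x)) by easy.
      assert (Hay : forall g, below a (act g y)) by easy.
      pose proof (HK _ _ (Hay (inv g)) (Hax (inv g))) as [A1 _].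
      pose proof (HK _ _ (Hay (inv h)) (Hax (inv h))) as [B1 B2].
      pose proof (HK _ _ (Hay (inv g)) (Hax (inv g))) as [_ A2].
      rewrite Di in * by auto. apply Rabs_le. lra.
Qed.

Lemma displacement_step a k : displacement_space (below a) (dist k) ->
  katetov_on (below a) (dist k) (k a) -> displacement_space (upto a) (dist k).
Proof.
  intros HD HK.
  destruct (orbit_dist_spec a (dist k) (k a) HD HK) as (S0 & Ss & St & Si & Sd & Su & Sl).
  destruct HD as (D0 & Ds & Dt & Di & Dd).
  assert (Hact : forall g x, below a x -> below a (act g x)) by easy.
  assert (Eact : forall g h, act g (a, h) = (a, g * h)) by easy.
  assert (Hcase : forall x, upto a x -> below a x \/ exists g, x = (a, g)).
  { intros [b g] [H|H]; [now left|right]. simpl in H. subst. eauto. }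
  split; [|split; [|split; [|split]]].
  - intros x Hx. destruct (Hcase x Hx) as [Lx|[g ->]]; [auto|]. now rewrite dist_eq.
  - intros x y Hx Hy. destruct (Hcase x Hx) as [Lx|[g ->]], (Hcase y Hy) as [Ly|[h ->]].
    + auto.
    + now rewrite dist_lt, dist_gt.
    + now rewrite dist_lt, dist_gt.
    + rewrite !dist_eq. auto.
  - intros x y z Hx Hy Hz.
    destruct (Hcase x Hx) as [Lx|[g ->]], (Hcase y Hy) as [Ly|[h ->]],
      (Hcase z Hz) as [Lz|[l ->]]; rewrite ?dist_eq, ?dist_lt, ?dist_gt by auto.
    + auto.
    + pose proof (HK (act (inv l) x) (act (inv l) y) (Hact _ _ Lx) (Hact _ _ Ly)) as [A _].
      rewrite Di in A by auto. lra.
    + pose proof (HK (act (inv h) x) (act (inv h) z) (Hact _ _ Lx) (Hact _ _ Lz)) as [_ A].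
      rewrite Di in A by auto. lra.
    + pose proof (Su h l x Lx) as A. apply Rabs_le_between in A. lra.
    + pose proof (HK (act (inv g) z) (act (inv g) y) (Hact _ _ Lz) (Hact _ _ Ly)) as [A _].
      rewrite Di, (Ds z y) in A by auto. lra.
    + auto.
    + pose proof (Su g h z Lz) as A. apply Rabs_le_between in A. lra.
    + auto.
  - intros l x y Hx Hy.
    destruct (Hcase x Hx) as [Lx|[g ->]], (Hcase y Hy) as [Ly|[h ->]];
      rewrite ?Eact, ?dist_eq, ?dist_lt, ?dist_gt by auto; auto.
    + rewrite act_act, tg_invM, <- tg_assoc, tg_mulVg, tg_mulg1. easy.
    + rewrite act_act, tg_invM, <- tg_assoc, tg_mulVg, tg_mulg1. easy.
  - intros l x Hx. destruct (Hcase x Hx) as [Lx|[g ->]]; [auto|].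
    rewrite Eact, dist_eq. auto.
Qed.

(** Each axiom involves at most three points, all of which lie up to the largest of their stages;
    limit and successor stages are thus treated alike. *)
Lemma displacement_below a D : (forall b, lt b a -> displacement_space (upto b) D) ->
  displacement_space (below a) D.
Proof.
  intros H.
  assert (Hmax : forall x y, exists z : point, upto (fst z) x /\ upto (fst z) y /\ (z = x \/ z = y)).
  { intros x y. unfold upto. destruct (lt_total (fst x) (fst y)) as [L|[L|L]].
    - exists y. auto.
    - exists y. auto.
    - exists x. auto. }
  assert (Hmax3 : forall x y z, below a x -> below a y -> below a z ->
    exists b, lt b a /\ upto b x /\ upto b y /\ upto b z).
  { intros x y z Hx Hy Hz. destruct (Hmax x y) as (w & Hw1 & Hw2 & Hw3).
    destruct (Hmax w z) as (v & Hv1 & Hv2 & Hv3). exists (fst v).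
    assert (T : forall u, upto (fst w) u -> upto (fst v) u).
    { unfold upto in *. intros u [Hu|Hu]; destruct Hv1 as [Hv|Hv]; rewrite ?Hu, <- ?Hv; eauto. }
    split; [|auto]. destruct Hv3 as [-> | ->]; [destruct Hw3 as [-> | ->]|]; auto. }
  split; [|split; [|split; [|split]]].
  - intros x Hx. destruct (Hmax3 x x x) as (b & Hb & Bx & _); auto. now apply (H b Hb).
  - intros x y Hx Hy. destruct (Hmax3 x y y) as (b & Hb & Bx & By & _); auto. now apply (H b Hb).
  - intros x y z Hx Hy Hz. destruct (Hmax3 x y z) as (b & Hb & Bx & By & Bz); auto.
    now apply (H b Hb).
  - intros g x y Hx Hy. destruct (Hmax3 x y y) as (b & Hb & Bx & By & _); auto. now apply (H b Hb).
  - intros g x Hx. destruct (Hmax3 x x x) as (b & Hb & Bx & _); auto. now apply (H b Hb).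
Qed.

Hypothesis M_regular : forall a (t : segment lt a -> M), exists c, forall i, lt (t i) c.
Hypothesis M_unbounded : forall a, exists b, lt a b.
Hypothesis e_cofinal : forall (o : task) (c : M), exists a, ~ lt a c /\ e a = Some o.

Theorem tower_exists : exists D : point -> point -> R,
  displacement_space (fun _ => True) D /\
  (forall g h, D (b0, g) (b0, h) = N (inv g * h)) /\
  (forall a (t : segment lt a -> point) (r : segment lt a -> R),
     katetov_family D t r -> exists x, forall i, D x (t i) = r i).
Proof.
  destruct (wf_choice M (point -> R) lt (fun _ => 0) stage_spec lt_wf) as [k Hk].
  { intros a k k' K. apply stage_spec_local. }
  assert (Hall : forall a, displacement_space (upto a) (dist k)).
  { intros a. induction a as [a IH] using (well_founded_ind lt_wf).
    pose proof (displacement_below _ _ IH) as HD.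
    apply displacement_step; [easy|]. now apply Hk, stage_exists. }
  assert (Hspec : forall a, stage_spec a k (k a)).
  { intros a. apply Hk, stage_exists, displacement_below. auto. }
  exists (dist k). split; [|split].
  - assert (Hb : forall a b c, exists d, lt a d /\ lt b d /\ lt c d).
    { assert (H2 : forall a b, exists d, lt a d /\ lt b d).
      { intros a b. destruct (M_unbounded a) as [a' Ha], (M_unbounded b) as [b' Hb].
        destruct (lt_total a' b') as [H|[H|H]]; [exists b' | exists b' | exists a']; subst; eauto. }
      intros a b c. destruct (H2 a b) as (d & Ha & Hb), (H2 d c) as (d' & Hd & Hc).
      exists d'. eauto. }
    split; [|split; [|split; [|split]]].
    + intros x _. apply (Hall (fst x)). now right.
    + intros x y _ _. destruct (Hb (fst x) (fst y) (fst y)) as (d & H1 & H2 & _).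
      apply (Hall d); now left.
    + intros x y z _ _ _. destruct (Hb (fst x) (fst y) (fst z)) as (d & H1 & H2 & H3).
      apply (Hall d); now left.
    + intros g x y _ _. destruct (Hb (fst x) (fst y) (fst y)) as (d & H1 & H2 & _).
      apply (Hall d); now left.
    + intros g x _. apply (Hall (fst x)). now right.
  - intros g h. rewrite dist_eq. unfold orbit_dist.
    now destruct (excluded_middle_informative _).
  (* Regularity bounds the stages of the points [t i] by some [c]. The task recurs at a stage [b]
     not below [c], and there the new point [(b, 1)] realises it. *)
  - intros a t r Hr. destruct (M_regular a (fun i => fst (t i))) as [c Hc].
    destruct (e_cofinal (existT _ a (t, r)) c) as (b & Hb & Eb).
    assert (Ht : forall i, below b (t i)).
    { intros i. unfold below. specialize (Hc i).
      destruct (lt_total c b) as [H|[H|H]]; [eauto | now subst | easy]. }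
    exists (b, 1). intros i. rewrite dist_gt, tg_inv1, act_one by auto.
    pose proof (proj2 (Hspec b)) as Hs. unfold solves_task in Hs. rewrite Eb in Hs. auto.
Qed.
End Tower.

(** * Identification with the Urysohn-Katetov space *)

Lemma task_card_le (M : Type) (lt : M -> M -> Prop) (G : TopGroup) :
  uncountable M -> powers_below_le M -> initial_order lt -> card_le G M ->
  card_le (task M lt G) M.
Proof.
  intros HM Hpow Hlt HG.
  assert (Hid : card_le M M) by now exists (fun x => x).
  assert (H : forall a, exists j : (segment lt a -> point M G) * (segment lt a -> R) -> M,
    injective j).
  { intros a. pose proof (Hpow _ (segment_card_lt M lt Hlt a)) as Ha.
    apply card_le_pairs; auto; refine (card_le_trans _ _ _ _ Ha); apply card_le_fun.
    - now apply card_le_pairs.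
    - now apply card_le_reals. }
  apply (card_le_trans _ (M * M)); [|now apply card_le_pairs].
  exists (fun o => (projT1 o,
    proj1_sig (constructive_indefinite_description _ (H (projT1 o))) (projT2 o))).
  intros [a p] [b q] E. injection E as Ea E. simpl in Ea. subst b. simpl in E.
  apply (proj2_sig (constructive_indefinite_description _ (H a))) in E. now subst.
Qed.

(** With [T * M] injected into [M], each element of [T] has as many codes as [M] has elements, too
    many to fit into a segment. *)
Lemma cofinal_enumeration (M T : Type) (lt : M -> M -> Prop) :
  uncountable M -> powers_below_le M -> initial_order lt -> card_le T M ->
  exists e : M -> option T, forall o c, exists a, ~ lt a c /\ e a = Some o.
Proof.
  intros HM Hpow Hlt HT.
  destruct (card_le_pairs M HM Hpow T M HT) as [q Hq]; [now exists (fun x => x)|].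
  exists (fun a => epsilon (inhabits None)
    (fun o => match o with Some t => exists c, q (t, c) = a | None => False end)).
  intros o c. destruct (unbounded_image M lt Hlt (fun x => q (o, x)) c) as [x Hx].
  { intros x y E. apply Hq in E. congruence. }
  exists (q (o, x)). split; [easy|].
  match goal with |- epsilon ?i ?P = _ => pose proof (epsilon_spec i P) as Hs;
    destruct (epsilon i P) as [t|] end.
  - destruct Hs as [c' Hc']; [now exists (Some o), x|]. apply Hq in Hc'. congruence.
  - destruct Hs. now exists (Some o), x.
Qed.

Lemma card_le_sum_surj (M X Y : Type) : uncountable M -> powers_below_le M ->
  card_le X M -> card_le Y M -> X -> exists e : M -> X + Y, surjective e.
Proof.
  intros HM Hpow [f Hf] [g Hg] x0. apply card_le_inv_surj; [|now left].
  apply (card_le_trans _ (M * bool)).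
  - exists (fun s => match s with inl x => (f x, true) | inr y => (g y, false) end).
    intros [x|y] [x'|y'] E; injection E; intros; try easy; f_equal; auto.
  - apply card_le_pairs; auto; [now exists (fun x => x)|].
    apply card_lt_countable; auto. exists (fun b : bool => if b then 0%nat else 1%nat).
    now intros [] [].
Qed.

Lemma card_le_lt_trans A B C : card_le A B -> card_lt B C -> card_lt A C.
Proof.
  intros HA [HB Hn]. split; [eauto using card_le_trans|].
  intros H. apply Hn. eauto using card_le_trans.
Qed.

Lemma weight_le_of_card (M : Type) (X : MetricSpace) :
  uncountable M -> powers_below_le M -> card_le X M -> weight_le (mopen (@ms_d X)) M.
Proof.
  intros HM Hpow HX. destruct (ms_metric X) as (Hd0 & Hd1 & Hds & Hdt).
  exists (X * nat)%type, (fun p y => ms_d (fst p) y < / INR (S (snd p))).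
  split; [|split].
  - apply card_le_pairs; auto. now apply uncountable_nat_le.
  - intros [x n] y Hy. cbn [fst snd] in *. exists (/ INR (S n) - ms_d x y). split; [lra|].
    intros z Hz. specialize (Hdt x y z). lra.
  - intros S x HS Hx. destruct (HS x Hx) as (eps & He & HSe).
    destruct (archimed_cor1 eps He) as ([|n] & Hn & Hn0); [lia|].
    exists (x, n). cbn [fst snd]. split.
    + rewrite (proj2 (Hd1 x x) eq_refl). apply Rinv_0_lt_compat, lt_0_INR. lia.
    + intros y Hy. apply HSe. lra.
Qed.

(** [None] is the new point; strict positivity of [r] keeps it apart from [X], so that a genuine
    metric results. *)
Lemma one_point_extension (X : MetricSpace) (r : X -> R) :
  katetov_on (fun _ => True) (@ms_d X) r -> (forall x, 0 < r x) ->
  is_metric (fun u v : option X =>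
    match u, v with
    | Some x, Some y => ms_d x y
    | Some x, None | None, Some x => r x
    | None, None => 0
    end).
Proof.
  intros Hr Hpos. destruct (ms_metric X) as (Hd0 & Hd1 & Hds & Hdt).
  assert (Hp : forall x, 0 <= r x) by (intros x; specialize (Hpos x); lra).
  split; [|split; [|split]].
  - intros [x|] [y|]; auto; lra.
  - intros [x|] [y|]; split; intros E.
    + f_equal. now apply Hd1.
    + apply Hd1. congruence.
    + specialize (Hpos x). lra.
    + easy.
    + specialize (Hpos y). lra.
    + easy.
    + easy.
    + easy.
  - intros [x|] [y|]; auto.
  - intros [x|] [y|] [z|]; auto.
    + destruct (Hr x y I I). lra.
    + destruct (Hr x z I I). lra.
    + specialize (Hp x). lra.
    + destruct (Hr z y I I). rewrite Hds. lra.
    + specialize (Hp y). lra.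
    + specialize (Hp z). lra.
    + lra.
Qed.

Lemma is_metric_sub (X : MetricSpace) (P : X -> Prop) :
  is_metric (fun a b : {x | P x} => ms_d (proj1_sig a) (proj1_sig b)).
Proof.
  destruct (ms_metric X) as (Hd0 & Hd1 & Hds & Hdt).
  split; [|split; [|split]]; auto.
  intros x y. rewrite Hd1. split; [apply proj1_sig_injective | congruence].
Qed.

(** Universality embeds the one-point extension of the range of [t] into [U]; homogeneity moves the
    embedded copy of that range back to its place, carrying the new point to the required [y]. *)
Lemma urysohn_katetov_injective (M : Type) (U : MetricSpace) (I : Type) (t : I -> U) (r : I -> R) :
  uncountable M -> powers_below_le M -> urysohn_katetov M U -> card_lt I M ->
  katetov_family (@ms_d U) t r ->
  exists y, forall i, ms_d y (t i) = r i.
Proof.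
  intros HM Hpow (_ & _ & Huniv & Hhom) HI Hr.
  destruct (ms_metric U) as (Hd0 & Hd1 & Hds & Hdt).
  (* A nonpositive value is zero by the Katetov inequalities, and then [t i] itself realises the
     family. *)
  destruct (classic (exists i, r i <= 0)) as [[i Hi]|Hn].
  { exists (t i). intros j. destruct (Hr i j), (Hr j i). rewrite (Hds (t j) (t i)) in *.
    specialize (Hd0 (t i) (t j)).
    destruct (Hr i i) as [_ Hii]. rewrite (proj2 (Hd1 (t i) (t i)) eq_refl) in Hii. lra. }
  assert (Hpos : forall i, 0 < r i) by (intros i; apply Rnot_le_lt; eauto).
  set (A := fun x => exists i, t i = x).
  set (X := Build_MetricSpace _ _ (is_metric_sub U A)).
  set (idx := fun x : X => proj1_sig (constructive_indefinite_description _ (proj2_sig x))).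
  assert (Hidx : forall x, t (idx x) = proj1_sig x).
  { intros x. apply (proj2_sig (constructive_indefinite_description _ (proj2_sig x))). }
  clearbody idx.
  assert (Hk : katetov_on (fun _ => True) (@ms_d X) (fun x => r (idx x))).
  { intros x y _ _. simpl. rewrite <- !Hidx. apply Hr. }
  set (Y := Build_MetricSpace _ _ (one_point_extension X _ Hk (fun x => Hpos (idx x)))).
  assert (HXI : card_le X I).
  { exists idx. intros x y E. apply proj1_sig_injective. now rewrite <- !Hidx, E. }
  destruct (Huniv Y) as [f Hf].
  { apply weight_le_of_card; auto. apply card_le_option; auto.
    exact (card_le_trans _ _ _ HXI (proj1 HI)). }
  set (B := fun y => exists x : X, f (Some x) = y).
  set (g := fun y : {y | B y} =>
    proj1_sig (constructive_indefinite_description _ (proj2_sig y)) : {x | A x}).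
  assert (Hg : forall y, f (Some (g y)) = proj1_sig y).
  { intros y. apply (proj2_sig (constructive_indefinite_description _ (proj2_sig y))). }
  clearbody g.
  assert (Hfi : forall x x' : X, f (Some x) = f (Some x') -> x = x').
  { intros x x' E. apply (proj1 (proj2 (ms_metric X))).
    change (@ms_d Y (Some x) (Some x') = 0). rewrite <- Hf. now apply Hd1. }
  destruct (Hhom B A g) as (h & [Hh _] & Hhg).
  - refine (card_le_lt_trans _ _ _ _ HI). apply (card_le_trans _ X); [|easy].
    exists g. intros x y E. apply proj1_sig_injective. now rewrite <- !Hg, E.
  - intros a b. rewrite <- !Hg, Hf. easy.
  - intros x. exists (exist _ (f (Some x)) (ex_intro _ x eq_refl)).
    apply Hfi. now rewrite Hg.
  - exists (h (f None)). intros i.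
    set (x := exist A (t i) (ex_intro _ i eq_refl) : X).
    assert (E : h (f (Some x)) = t i).
    { set (z := exist B (f (Some x)) (ex_intro _ x eq_refl)).
      change (h (proj1_sig z) = t i). rewrite Hhg. now rewrite (Hfi (g z) x (Hg z)). }
    rewrite <- E, Hh, Hf. simpl.
    (* The index chosen for [t i] may differ from [i], but the Katetov inequalities at distance zero
       make the two values of [r] equal. *)
    destruct (Hr i (idx x)), (Hr (idx x) i). rewrite Hidx in *. simpl in *.
    rewrite (proj2 (Hd1 (t i) (t i)) eq_refl) in *. lra.
Qed.

(** * Back and forth, and transport of the action *)

Definition pseudometric {X : Type} (D : X -> X -> R) : Prop :=
  (forall x, D x x = 0) /\ (forall x y, D x y = D y x) /\
  (forall x y z, D x z <= D x y + D y z).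

(** At stage [a] the surjection [e] prescribes one coordinate of the pair [f a]; the extension
    property on the other side supplies a partner with the same distances to the earlier pairs. The
    result is a relation, since in a pseudometric space a point may have several partners. *)
Lemma back_and_forth (M X Y : Type) (lt : M -> M -> Prop)
    (DX : X -> X -> R) (DY : Y -> Y -> R) (e : M -> X + Y) (x0 : X) (y0 : Y) :
  strict_well_order lt -> pseudometric DX -> pseudometric DY -> surjective e ->
  (forall a (t : segment lt a -> X) r, katetov_family DX t r ->
     exists x, forall i, DX x (t i) = r i) ->
  (forall a (t : segment lt a -> Y) r, katetov_family DY t r ->
     exists y, forall i, DY y (t i) = r i) ->
  exists S : X -> Y -> Prop,
    (forall x, exists y, S x y) /\ (forall y, exists x, S x y) /\
    (forall x y x' y', S x y -> S x' y' -> DX x x' = DY y y').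
Proof.
  intros (Hwf & Htr & Htot) (X0 & Xs & Xt) (Y0 & Ys & Yt) He HX HY.
  set (Q := fun a (f : M -> X * Y) (p : X * Y) =>
    (match e a with inl x => fst p = x | inr y => snd p = y end) /\
    forall b, lt b a -> DX (fst p) (fst (f b)) = DY (snd p) (snd (f b))).
  destruct (wf_choice M (X * Y) lt (x0, y0) Q Hwf) as [f Hf].
  { intros a f f' p E [H1 H2]. split; [easy|]. intros b Hb. rewrite <- E; auto. }
  assert (Hiso : forall b c, (lt c b -> Q b f (f b)) -> (lt b c -> Q c f (f c)) ->
    DX (fst (f b)) (fst (f c)) = DY (snd (f b)) (snd (f c))).
  { intros b c Hb Hc. destruct (Htot b c) as [H|[<- |H]].
    - rewrite Xs, Ys. now apply Hc.
    - now rewrite X0, Y0.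
    - now apply Hb. }
  assert (HQ : forall a, Q a f (f a)).
  { intros a. induction a as [a IH] using (well_founded_ind Hwf). apply Hf.
    unfold Q at 1. destruct (e a) as [x|y].
    - destruct (HY a (fun i => snd (f (proj1_sig i))) (fun i => DX x (fst (f (proj1_sig i)))))
        as [y Hy].
      + intros [b Hb] [c Hc]. simpl. rewrite <- Hiso by auto.
        pose proof (Xt x (fst (f c)) (fst (f b))). pose proof (Xt (fst (f b)) x (fst (f c))).
        rewrite (Xs (fst (f c)) (fst (f b))) in *. rewrite (Xs (fst (f b)) x) in *. lra.
      + exists (x, y). split; [easy|]. intros b Hb. symmetry. exact (Hy (exist _ b Hb)).
    - destruct (HX a (fun i => fst (f (proj1_sig i))) (fun i => DY y (snd (f (proj1_sig i)))))
        as [x Hx].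
      + intros [b Hb] [c Hc]. simpl. rewrite Hiso by auto.
        pose proof (Yt y (snd (f c)) (snd (f b))). pose proof (Yt (snd (f b)) y (snd (f c))).
        rewrite (Ys (snd (f c)) (snd (f b))) in *. rewrite (Ys (snd (f b)) y) in *. lra.
      + exists (x, y). split; [easy|]. intros b Hb. exact (Hx (exist _ b Hb)). }
  exists (fun x y => exists a, f a = (x, y)). split; [|split].
  - intros x. destruct (He (inl x)) as [a Ha]. destruct (HQ a) as [H _]. rewrite Ha in H.
    exists (snd (f a)), a. subst x. now destruct (f a).
  - intros y. destruct (He (inr y)) as [a Ha]. destruct (HQ a) as [H _]. rewrite Ha in H.
    exists (fst (f a)), a. subst y. now destruct (f a).
  - intros x y x' y' [a Ha] [b Hb]. pose proof (Hiso a b (fun _ => HQ a) (fun _ => HQ b)) as H.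
    now rewrite Ha, Hb in H.
Qed.

(* Transporting the action along a distance-preserving correspondence [S]
   avoids passing to the metric quotient of the tower. *)
Lemma embeds_in_Iso_of_correspondence (M : Type) (b0 : M) (G : TopGroup) (N : G -> R)
    (D : point M G -> point M G -> R) (U : MetricSpace) (S : point M G -> U -> Prop) :
  metrizable G -> compatible_length G N ->
  displacement_space M G N (fun _ => True) D ->
  (forall g h, D (b0, g) (b0, h) = N (tg_mul G (tg_inv G g) h)) ->
  (forall x, exists y, S x y) -> (forall y, exists x, S x y) ->
  (forall x y x' y', S x y -> S x' y' -> D x x' = ms_d y y') ->
  embeds_in_Iso G U.
Proof.
  intros (dG & (dG0 & dG1 & _) & HdG) (_ & _ & _ & _ & _ & Ntop) (D0 & Ds & Dt & Di & Dd)
    Hbase Stot Sonto Siso.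
  destruct (ms_metric U) as (Hd0 & Hd1 & Hds & Hdt).
  assert (Sfun : forall x y y', S x y -> S x y' -> y = y').
  { intros x y y' H H'. apply Hd1. rewrite <- (Siso x y x y'), D0; auto. }
  assert (Hex : forall g y, exists y', exists x, S x y /\ S (act M G g x) y').
  { intros g y. destruct (Sonto y) as [x Hx], (Stot (act M G g x)) as [y' Hy']. eauto. }
  set (phi := fun g y => proj1_sig (constructive_indefinite_description _ (Hex g y))).
  (* The value [phi g y] does not depend on the chosen partner of [y]: two partners are at distance
     zero, the action preserves this, and points of [U] at distance zero coincide. *)
  assert (Hphi : forall g x y, S x y -> S (act M G g x) (phi g y)).
  { intros g x y H. unfold phi.
    destruct (constructive_indefinite_description _ (Hex g y)) as (y' & x' & H1 & H2). simpl.
    destruct (Stot (act M G g x)) as [y2 Hy2]. replace y' with y2; [easy|].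
    apply Hd1. rewrite <- (Siso _ _ _ _ Hy2 H2), Di by auto.
    rewrite (Siso _ _ _ _ H H1). now apply Hd1. }
  clearbody phi.
  assert (Hmul : forall g h y, phi (tg_mul G g h) y = phi g (phi h y)).
  { intros g h y. destruct (Sonto y) as [x Hx].
    apply (Sfun (act M G (tg_mul G g h) x)); [auto|]. rewrite <- act_act. auto. }
  assert (Hone : forall y, phi (tg_one G) y = y).
  { intros y. destruct (Sonto y) as [x Hx]. apply (Sfun x); [|easy].
    rewrite <- (act_one M G x). auto. }
  assert (Hdisp : forall g h y, ms_d (phi h y) (phi g y) <= N (tg_mul G (tg_inv G g) h)).
  { intros g h y. destruct (Sonto y) as [x Hx].
    rewrite <- (Siso _ _ _ _ (Hphi h _ _ Hx) (Hphi g _ _ Hx)).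
    rewrite <- (Di (tg_inv G g)), act_invl, act_act by auto. auto. }
  destruct (Stot (b0, tg_one G)) as [y0 Hy0].
  assert (Hy : forall g h, ms_d (phi g y0) (phi h y0) = N (tg_mul G (tg_inv G g) h)).
  { intros g h. rewrite <- (Siso _ _ _ _ (Hphi g _ _ Hy0) (Hphi h _ _ Hy0)).
    unfold act. simpl. rewrite !tg_mulg1. apply Hbase. }
  assert (Htop : forall W, tg_open G W -> exists O, popen U O /\ forall g, W g <-> O (phi g)).
  { intros W HW. rewrite Ntop in HW.
    (* The open set constrains only the value at [y0]: it is a union of conditions that place [f y0]
       in a ball around some [phi g y0], small enough to force membership in [W]. *)
    exists (fun f => exists g eps, W g /\ 0 < eps /\
      (forall h, N (tg_mul G (tg_inv G g) h) < eps -> W h) /\ ms_d (phi g y0) (f y0) < eps).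
    split.
    - intros f (g & eps & Hg & He & HWe & Hf).
      exists [y0], (eps - ms_d (phi g y0) (f y0)). split; [lra|].
      intros h Hh. exists g, eps. repeat split; auto.
      specialize (Hh y0 (or_introl eq_refl)).
      specialize (Hdt (phi g y0) (f y0) (h y0)). rewrite (Hds (f y0) (h y0)) in Hdt. lra.
    - intros g. split.
      + intros Hg. destruct (HW g Hg) as (eps & He & HWe). exists g, eps.
        repeat split; auto. now rewrite (proj2 (Hd1 _ _) eq_refl).
      + intros (h & eps & Hh & He & HWe & Hlt). apply HWe. now rewrite <- Hy. }
  exists phi. split; [|split; [|split; [|split]]].
  - intros g. split.
    + intros y z. destruct (Sonto y) as [x Hx], (Sonto z) as [x' Hx'].
      rewrite <- (Siso _ _ _ _ (Hphi g _ _ Hx) (Hphi g _ _ Hx')), Di by auto. auto.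
    + intros y. exists (phi (tg_inv G g) y). now rewrite <- Hmul, tg_mulgV.
  - intros g h. apply functional_extensionality. auto.
  - intros g h E. apply NNPP. intros Hn.
    (* Injectivity follows by applying [Htop] to the complement of a point, which is open by
       metrizability. *)
    assert (Ho : tg_open G (fun x => x <> h)).
    { apply HdG. intros x Hx. exists (dG x h). split.
      - destruct (dG0 x h) as [H|H]; [easy|]. now destruct Hx; apply dG1.
      - intros y Hlt ->. lra. }
    destruct (Htop _ Ho) as (O & _ & HO).
    apply (proj2 (HO h)); [|easy]. rewrite <- E. now apply HO.
  - intros O HO. apply Ntop. intros g Hg. destruct (HO _ Hg) as (xs & eps & He & Hh).
    (* The same [eps] serves every point of [xs], because the displacement bound is uniform. *)
    exists eps. split; [easy|]. intros h Hlt. apply Hh. intros x _.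
    eapply Rle_lt_trans; [apply Hdisp|easy].
  - easy.
Qed.

Theorem theorem4p6p4 (M : Type) :
  uncountable M ->
  sup_pow_below_eq M ->
  forall U : MetricSpace, urysohn_katetov M U ->
  forall G : TopGroup, metrizable G -> SIN_group G -> weight_le (tg_open G) M ->
  embeds_in_Iso G U.
Proof.
  intros HM [Hpow _] U HU G HG HSIN Hw.
  destruct (compatible_length_exists G HG HSIN) as [N HN].
  destruct (initial_order_exists M) as [lt Hlt].
  pose proof Hlt as ((Hwf & Htr & Htot) & _).
  assert (HGM : card_le G M).
  { destruct HG as (d & Hd & Hop). now apply (weight_le_card G d (tg_open G)). }
  assert (HUM : card_le U M).
  { destruct HU as (_ & [(D & HD & f & Hf & _) _] & _).
    apply (density_le_card U D); auto. now exists f. }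
  destruct (cofinal_enumeration M (task M lt G) lt) as [e He]; auto using task_card_le.
  destruct (uncountable_nat_le M HM) as [nM _].
  assert (Hb0 : exists b0, forall b, ~ lt b b0).
  { apply NNPP. intros Hn. generalize (nM 0%nat). intros a.
    induction a as [a IH] using (well_founded_ind Hwf).
    apply Hn. exists a. intros b Hb. exact (IH b Hb). }
  destruct Hb0 as [b0 Hb0].
  destruct (tower_exists M lt Hwf Htr Htot b0 Hb0 G N HN e) as (D & HD & Hbase & Hinj); auto.
  { intros a t. now apply initial_order_regular. }
  { intros a. now apply no_maximum. }
  assert (HPM : card_le (point M G) M).
  { apply card_le_pairs; auto. now exists (fun x => x). }
  assert (y0 : inhabited U).
  { destruct HU as (_ & [(DU & _ & f & _ & Hf) _] & _).
    destruct (Hf (nM 0%nat)) as [x _]. constructor. exact (proj1_sig x). }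
  destruct y0 as [y0].
  destruct (card_le_sum_surj M (point M G) U HM Hpow HPM HUM (b0, tg_one G)) as [e' He'].
  destruct (back_and_forth M (point M G) U lt D (@ms_d U) e' (b0, tg_one G) y0)
    as (S & S1 & S2 & S3); auto.
  - apply Hlt.
  - destruct HD as (D0 & Ds & Dt & _). repeat split; auto.
  - destruct (ms_metric U) as (_ & d1 & ds & dt). repeat split; auto.
    intros x. now apply d1.
  - intros a t r Hr. apply (urysohn_katetov_injective M U (segment lt a) t r); auto.
    now apply segment_card_lt.
  - now apply (embeds_in_Iso_of_correspondence M b0 G N D U S).
Qed.
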